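(* For every $4\times 4$ real symmetric positive definite matrix $A$ we have $R(A) < \frac{27}{16}$, and $\frac{27}{16}$ is the supremum of $R$ over all such matrices. Moreover this supremum is approximated by the matrices $$A(\epsilon):=\begin{bmatrix}1 & 1-\epsilon & 1-\epsilon & 1-\epsilon\\ 1-\epsilon & 1 & 1-3\epsilon+\epsilon^2 & 1-\epsilon\\ 1-\epsilon & 1-3\epsilon+\epsilon^2 & 1 & 1-\epsilon\\ 1-\epsilon & 1-\epsilon & 1-\epsilon & 1\end{bmatrix}$$ as $\epsilon\to 0^+$; that is, $A(\epsilon)$ is positive definite for all sufficiently small $\epsilon>0$ and $\lim_{\epsilon\to 0^+}R(A(\epsilon))=\frac{27}{16}$.
   Context: For a $4\times4$ matrix $A$ and an index set $\alpha\subseteq\{1,2,3,4\}$, $A[\alpha]$ denotes the principal submatrix of $A$ with rows and columns indexed by $\alpha$. For a positive definite $A$, $$R(A):=\frac{\det A[\{1,2,4\}]\,\det A[\{1,3,4\}]\,\det A[\{2,3\}]\,\det A[\{1\}]\,\det A[\{4\}]}{\det A[\{1,2\}]\,\det A[\{1,3\}]\,\det A[\{1,4\}]\,\det A[\{2,4\}]\,\det A[\{3,4\}]}.$$ *)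

(* Defs.v *)
From mathcomp Require Import all_boot all_order all_algebra.
From mathcomp Require Import all_classical all_reals all_analysis.
Set Implicit Arguments.
Unset Strict Implicit.
Unset Printing Implicit Defensive.
Import GRing.Theory Num.Theory.
Local Open Scope ring_scope.

Definition posdefmx (R : realFieldType) (n : nat) (A : 'M[R]_n) : Prop :=
  A \is symmetricmx /\
  forall x : 'cV[R]_n, x != 0 -> 0 < (x^T *m A *m x) 0 0.

(* [enum_val] lists the elements of [a] in increasing order. *)
Definition principal_submx (R : Type) (n : nat) (A : 'M[R]_n)
    (a : {set 'I_n}) : 'M[R]_#|a| :=
  mxsub (@enum_val _ (mem a)) (@enum_val _ (mem a)) A.

Definition pminor (R : comPzRingType) (n : nat) (A : 'M[R]_n)
    (a : {set 'I_n}) : R :=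
  \det (principal_submx A a).

(* Rows and columns are numbered from 0: the mathematical indices 1, 2, 3, 4
   are 0, 1, 2, 3 : 'I_4 below. *)
Definition detratio (R : fieldType) (A : 'M[R]_4) : R :=
  (pminor A [set 0; 1; 3] * pminor A [set 0; 2; 3] * pminor A [set 1; 2] *
   pminor A [set 0] * pminor A [set 3]) /
  (pminor A [set 0; 1] * pminor A [set 0; 2] * pminor A [set 0; 3] *
   pminor A [set 1; 3] * pminor A [set 2; 3]).

Definition Aeps (R : pzRingType) (e : R) : 'M[R]_4 :=
  \matrix_(i < 4, j < 4) nth 0 (nth [::]
    [:: [:: 1;     1 - e;               1 - e;               1 - e];
        [:: 1 - e; 1;                   1 - 3 * e + e ^+ 2;  1 - e];
        [:: 1 - e; 1 - 3 * e + e ^+ 2;  1;                   1 - e];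
        [:: 1 - e; 1 - e;               1 - e;               1    ]] i) j.

(* Main.v *)
Require Import Defs.
From mathcomp Require Import all_boot all_order all_algebra.
From mathcomp Require Import all_classical all_reals all_analysis.
From mathcomp Require Import ring lra.
Set Implicit Arguments.
Unset Strict Implicit.
Unset Printing Implicit Defensive.
Import Order.TTheory GRing.Theory Num.Theory.
Import numFieldNormedType.Exports.
Local Open Scope classical_set_scope.
Local Open Scope ring_scope.

(* [R(A)] is invariant under diagonal scaling, so let [A] be the Gram matrix of
   unit vectors [v1, ..., v4] with entries a = A12, b = A13, c = A14, d = A23,
   e = A24, f = A34.  As a function of [d] alone, [R] is a constant times
   1 - d^2, hence it is largest at d = 0 if this keeps [A] semidefinite, and
   otherwise at the endpoint of the feasible interval nearest to 0, where [A] is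
   singular.  The case d = 0 is far from extremal and is settled by Koteljanskii
   inequalities such as det A[1,2,4] det A[1] <= det A[1,2] det A[1,4].
   In the singular case v1, ..., v4 are the vertices of a spherical
   quadrilateral.  With the angles of the triangles 1 2 4 and 1 3 4 at the
   vertices 1 and 4 fixed, [R] is an affine function of c = cos(v1, v4); so it is
   at most the larger of its values at c = 1 and c = -1, which are those of
   Euclidean quadrilaterals.  Such a value is at most
   (1 + cos s) (1 + cos t) (1 - cos (s + t)) / 2 for some angles s and t, which is
   at most (1 + p)^3 (1 - p) <= 27/16 for p = (cos s + cos t) / 2. *)

(** * The singular case: planar and spherical trigonometry *)

Lemma cube_bound (R : realFieldType) (p : R) : (1 + p) ^+ 3 * (1 - p) <= 27 / 16.
Proof.
rewrite -subr_ge0.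
(* The maximum is attained at p = 1/2, hence the double root. *)
have -> : 27 / 16 - (1 + p) ^+ 3 * (1 - p)
  = (p - 1 / 2) ^+ 2 * ((p + 3 / 2) ^+ 2 + 1 / 2) by field.
by rewrite mulr_ge0 ?addr_ge0 ?sqr_ge0 // divr_ge0.
Qed.

Lemma unit_circle_le1 (R : realFieldType) (s c : R) : s ^+ 2 + c ^+ 2 = 1 -> -1 <= c <= 1.
Proof. by move=> h; apply/andP; split; nra. Qed.

Lemma unit_circle_norm (R : realFieldType) (s c : R) : s ^+ 2 + c ^+ 2 = 1 -> `|c| <= 1.
Proof. by rewrite ler_norml; apply: unit_circle_le1. Qed.

(** For angles s, t the last factor is 1 - cos (s + t) = 2 sin^2 ((s + t) / 2). It is at most 2 - 2
    p^2, because p = cos ((s + t) / 2) cos ((s - t) / 2). The other two factors are handled by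
    AM-GM. *)
Lemma half_angle_bound (R : realFieldType) (s2 c2 s3 c3 : R) :
  s2 ^+ 2 + c2 ^+ 2 = 1 -> s3 ^+ 2 + c3 ^+ 2 = 1 ->
  (1 + c2) * (1 + c3) * (1 - c2 * c3 + s2 * s3) <= 27 / 8.
Proof.
move=> u2 u3; pose p := (c2 + c3) / 2.
have /andP[l2 _] := unit_circle_le1 u2; have /andP[l3 _] := unit_circle_le1 u3.
have P : (1 + c2) * (1 + c3) <= (1 + p) ^+ 2.
  by rewrite -subr_ge0 (_ : _ - _ = ((c2 - c3) / 2) ^+ 2) ?sqr_ge0 // /p; field.
have P0 : 0 <= (1 + c2) * (1 + c3) by apply: mulr_ge0; lra.
have Q : 1 - c2 * c3 + s2 * s3 <= 2 - 2 * p ^+ 2.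
  have := sqr_ge0 (s2 - s3); rewrite /p; nra.
have Q0 : 0 <= 2 - 2 * p ^+ 2.
  have /andP[_ m2] := unit_circle_le1 u2; have /andP[_ m3] := unit_circle_le1 u3.
  have : 0 <= (1 - p) * (1 + p) by apply: mulr_ge0; rewrite /p; lra.
  nra.
apply: le_trans (ler_wpM2l P0 Q) _; apply: le_trans (ler_wpM2r Q0 P) _.
have := cube_bound p; set t := _ * (1 - p) => ht.
have -> : (1 + p) ^+ 2 * (2 - 2 * p ^+ 2) = 2 * t by rewrite /t; ring.
by clearbody t; lra.
Qed.

Lemma planar_norm_bound (R : realFieldType) (s2 c2 s3 c3 : R) :
  s2 ^+ 2 + c2 ^+ 2 = 1 -> s3 ^+ 2 + c3 ^+ 2 = 1 ->
  1 - c2 * c3 * (c2 * c3 - s2 * s3)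
    + `|s2 * c3 + c2 * s3| * (`|s2| + `|s3|) + `|s2 * s3| <= 27 / 8.
Proof.
move=> u2 u3; rewrite normrM.
have N (x : R) : exists2 p, p ^+ 2 = 1 & `|x| = p * x.
  case: (ler0P x) => _; [exists (- 1) | exists 1]; rewrite ?sqrrN ?expr1n //.
    by rewrite mulN1r.
  by rewrite mul1r.
have [p hp ->] := N s2; have [q hq ->] := N s3; have [m hm ->] := N (s2 * c3 + c2 * s3).
have e2 : s2 ^+ 2 = 1 - c2 ^+ 2 by rewrite -u2; ring.
have e3 : s3 ^+ 2 = 1 - c3 ^+ 2 by rewrite -u3; ring.
(* For these signs the two left-hand sides are equal: reflecting the angles absorbs every absolute
   value. *)
apply: le_trans (@half_angle_bound R (p * s2) (m * q * c2) (q * s3) (m * p * c3) _ _).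
- rewrite le_eqVlt; apply/orP; left; apply/eqP.
  ring: hp hq hm e2 e3.
- by rewrite !exprMn hp hq hm !mul1r.
- by rewrite !exprMn hp hq hm !mul1r.
Qed.

Lemma unit_circleM (R : realFieldType) (s c t d : R) :
  s ^+ 2 + c ^+ 2 = 1 -> t ^+ 2 + d ^+ 2 = 1 ->
  (s * d + c * t) ^+ 2 + (c * d - s * t) ^+ 2 = 1.
Proof.
move=> h1 h2; rewrite -[RHS]mulr1 -{1}h1 -h2; ring.
Qed.

(* For a Euclidean quadrilateral 1 2 4 3 whose triangles 1 2 4 and 1 3 4 have angles
   [B], [C] and [B'], [C'] at 1 and 4, the left-hand side is
   (sin A sin A' |23| / |14|)^2, with [A], [A'] the angles at 2 and 3.  It is
   rewritten in terms of the sums B + C, B' + C' ([x], [y], [x'], [y']) and of the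
   differences B - C, B' - C' ([t], [w], [t'], [w']), and is then bounded by
   replacing the cosines that involve differences by 1 or -1. *)
Lemma planar_bound (R : realFieldType) (sB cB sC cC sB' cB' sC' cC' : R) :
  sB ^+ 2 + cB ^+ 2 = 1 -> sC ^+ 2 + cC ^+ 2 = 1 ->
  sB' ^+ 2 + cB' ^+ 2 = 1 -> sC' ^+ 2 + cC' ^+ 2 = 1 ->
  (sB * cC + cB * sC) ^+ 2 * sB' ^+ 2 + (sB' * cC' + cB' * sC') ^+ 2 * sB ^+ 2
  - 2 * (cC * cC' - sC * sC') * (sB * cC + cB * sC) * (sB' * cC' + cB' * sC')
      * sB * sB' <= 27 / 16.
Proof.
move=> uB uC uB' uC'.
have N (s c : R) : s ^+ 2 + c ^+ 2 = 1 -> (- s) ^+ 2 + c ^+ 2 = 1 by rewrite sqrrN.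
have ua := unit_circleM uB uC; have ua' := unit_circleM uB' uC'.
have ub := unit_circleM uB (N _ _ uC); have ub' := unit_circleM uB' (N _ _ uC').
have := planar_norm_bound ua ua'.
set x := sB * cC + cB * sC in ua *; set y := cB * cC - sB * sC in ua *.
set x' := sB' * cC' + cB' * sC' in ua' *; set y' := cB' * cC' - sB' * sC' in ua' *.
set t := _ + cB * - sC in ub; set w := _ - sB * - sC in ub.
set t' := _ + cB' * - sC' in ub'; set w' := _ - sB' * - sC' in ub'.
have ubb := unit_circleM ub ub'.
have -> : x ^+ 2 * sB' ^+ 2 + x' ^+ 2 * sB ^+ 2
    - 2 * (cC * cC' - sC * sC') * x * x' * sB * sB'
  = (1 - y * y' * (y * y' - x * x') - (x * y' + y * x') * (x * w' + x' * w)
      + x * x' * (w * w' - t * t')) / 2.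
  have eB : sB ^+ 2 = 1 - cB ^+ 2 by rewrite -uB; ring.
  have eB' : sB' ^+ 2 = 1 - cB' ^+ 2 by rewrite -uB'; ring.
  have eC : sC ^+ 2 = 1 - cC ^+ 2 by rewrite -uC; ring.
  have eC' : sC' ^+ 2 = 1 - cC' ^+ 2 by rewrite -uC'; ring.
  rewrite /x /y /x' /y' /t /w /t' /w'.
  by field: eB eB' eC eC'.
have l1 : - ((x * y' + y * x') * (x * w' + x' * w)) <= `|x * y' + y * x'| * (`|x| + `|x'|).
  apply: le_trans (ler_norm _) _; rewrite normrN normrM ler_wpM2l //.
  apply: le_trans (ler_normD _ _) _; rewrite !normrM.
  by apply: lerD; rewrite ler_piMr // ?(unit_circle_norm ub') ?(unit_circle_norm ub).
have l2 : x * x' * (w * w' - t * t') <= `|x * x'|.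
  apply: le_trans (ler_norm _) _.
  by rewrite normrM ler_piMr // (unit_circle_norm ubb).
lra.
Qed.

(* [g] is the cosine of the side 1 4, and [B], [C] (resp. [B'], [C']) are the angles
   at 1 and 4 of the triangle 1 2 4 (resp. 1 3 4); the left-hand side is affine in
   [g], and is an instance of [planar_bound] for g = 1 and g = -1. *)
Lemma singular_bound (R : realFieldType) (g sB cB sC cC sB' cB' sC' cC' P P' k : R) :
  sB ^+ 2 + cB ^+ 2 = 1 -> sC ^+ 2 + cC ^+ 2 = 1 ->
  sB' ^+ 2 + cB' ^+ 2 = 1 -> sC' ^+ 2 + cC' ^+ 2 = 1 -> -1 <= g <= 1 ->
  P = g * cC * sB + sC * cB -> P' = g * cC' * sB' + sC' * cB' ->
  k = cC * cC' - sC * sC' ->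
  sB ^+ 2 * sB' ^+ 2 * (1 - g ^+ 2) * (1 - k ^+ 2)
   + P ^+ 2 * sB' ^+ 2 + P' ^+ 2 * sB ^+ 2 - 2 * k * P * P' * sB * sB' <= 27 / 16.
Proof.
move=> uB uC uB' uC' /andP[g0 g1] -> -> ->.
have h1 := planar_bound uB uC uB' uC'.
(* Replacing B and B' by their supplements turns the value at g = 1 into the one at g = -1. *)
have nB : sB ^+ 2 + (- cB) ^+ 2 = 1 by rewrite sqrrN.
have nB' : sB' ^+ 2 + (- cB') ^+ 2 = 1 by rewrite sqrrN.
have h2 := planar_bound nB uC nB' uC'.
set e1 := (X in X <= _) in h1; set e2 := (X in X <= _) in h2.
(* The terms in g^2 cancel because (k - cC cC')^2 = (1 - cC^2) (1 - cC'^2). *)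
rewrite [leLHS](_ : _ = ((1 + g) * e1 + (1 - g) * e2) / 2); last first.
  have eC : sC ^+ 2 = 1 - cC ^+ 2 by rewrite -uC; ring.
  have eC' : sC' ^+ 2 = 1 - cC' ^+ 2 by rewrite -uC'; ring.
  rewrite /e1 /e2.
  by field: eC eC'.
have : (1 + g) * e1 <= (1 + g) * (27 / 16) by apply: ler_wpM2l => //; lra.
have : (1 - g) * e2 <= (1 - g) * (27 / 16) by apply: ler_wpM2l => //; lra.
lra.
Qed.

(* [d] is a root of det A, quadratic in [d]; the other root comes from [- n]. *)
Lemma singular_det_bound (R : realFieldType) (a b c d e f x y z u v m n : R) :
  0 < x -> 0 < y -> 0 < z -> 0 < u -> 0 < v ->
  x ^+ 2 = 1 - a ^+ 2 -> y ^+ 2 = 1 - b ^+ 2 -> z ^+ 2 = 1 - c ^+ 2 ->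
  u ^+ 2 = 1 - e ^+ 2 -> v ^+ 2 = 1 - f ^+ 2 ->
  m ^+ 2 = 1 + 2 * a * c * e - a ^+ 2 - c ^+ 2 - e ^+ 2 ->
  n ^+ 2 = 1 + 2 * b * c * f - b ^+ 2 - c ^+ 2 - f ^+ 2 ->
  d = (a * b + e * f - c * (a * f + b * e) - m * n) / z ^+ 2 ->
  m ^+ 2 * n ^+ 2 * (1 - d ^+ 2)
    <= 27 / 16 * (x ^+ 2 * y ^+ 2 * z ^+ 2 * u ^+ 2 * v ^+ 2).
Proof.
move=> x0 y0 z0 u0 v0 hx hy hz hu hv hm hn hd.
have nx := lt0r_neq0 x0; have ny := lt0r_neq0 y0; have nz := lt0r_neq0 z0.
have nu := lt0r_neq0 u0; have nv := lt0r_neq0 v0.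
have pos : 0 < x ^+ 2 * y ^+ 2 * z ^+ 2 * u ^+ 2 * v ^+ 2 by rewrite !mulr_gt0 ?exprn_gt0.
have gc : -1 <= c <= 1 by apply: (@unit_circle_le1 _ z); rewrite hz subrK.
have U (p q r w : R) : p != 0 -> q != 0 -> r ^+ 2 + w ^+ 2 = p ^+ 2 * q ^+ 2 ->
    (r / (p * q)) ^+ 2 + (w / (p * q)) ^+ 2 = 1.
  move=> np nq h; rewrite !expr_div_n -mulrDl h exprMn divff //.
  by rewrite mulf_neq0 // sqrf_eq0.
(* Spherical law of cosines: x, z, u are the sines of the sides 1 2, 1 4, 2 4, so sin B = m / (x z)
   and cos B = (e - a c) / (x z). The other angles are similar. *)
have uB : (m / (x * z)) ^+ 2 + ((e - a * c) / (x * z)) ^+ 2 = 1.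
  by apply: U => //; rewrite hm hx hz; ring.
have uC : (m / (z * u)) ^+ 2 + ((a - e * c) / (z * u)) ^+ 2 = 1.
  by apply: U => //; rewrite hm hu hz; ring.
have uB' : (n / (y * z)) ^+ 2 + ((f - b * c) / (y * z)) ^+ 2 = 1.
  by apply: U => //; rewrite hn hy hz; ring.
have uC' : (n / (z * v)) ^+ 2 + ((b - f * c) / (z * v)) ^+ 2 = 1.
  by apply: U => //; rewrite hn hv hz; ring.
have := @singular_bound _ c _ _ _ _ _ _ _ _ (z * e * (m / (x * z)) / u)
  (z * f * (n / (y * z)) / v) ((d - e * f) / (u * v)) uB uC uB' uC' gc.
(* With A the angle at 2, this is sin A cos(24) = cos(14) cos C sin B + sin C cos B; the sine rule
   gives sin A = z sin B / u. *)
have SB (p q r w w' : R) : p != 0 -> q != 0 -> z * w * (r / (p * z)) / q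
    = c * ((w' - w * c) / (z * q)) * (r / (p * z)) + r / (z * q) * ((w - w' * c) / (p * z)).
  move=> np nq; have -> : z * w * (r / (p * z)) / q = (z ^+ 2 * w * r) / (p * z ^+ 2 * q).
    by field; rewrite np nq nz.
  by rewrite {1}hz; field; rewrite np nq nz.
move=> /(_ (SB _ _ _ _ _ nx nu) (SB _ _ _ _ _ ny nv)).
(* The choice of [d] enters here: the angle at 4 of the triangle 2 3 4 is C + C'. *)
have kE : (d - e * f) / (u * v)
    = (a - e * c) / (z * u) * ((b - f * c) / (z * v)) - m / (z * u) * (n / (z * v)).
  have ef : e * f = e * f * (1 - c ^+ 2) / z ^+ 2 by rewrite -hz mulfK // sqrf_eq0.
  rewrite {}hd [X in (_ - X) / _]ef.
  by field; rewrite nu nv nz.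
move=> /(_ kE).
rewrite -(ler_pM2r pos); congr (_ <= _).
rewrite -hz.
have he : e ^+ 2 = 1 - u ^+ 2 by rewrite hu; ring.
have hf : f ^+ 2 = 1 - v ^+ 2 by rewrite hv; ring.
field: he hf.
by rewrite nu nv nx ny nz.
Qed.

(** * The case d = 0 *)

(** The last hypothesis is D14 det A >= 0 at d = 0. If the bound failed, Koteljanskii inequalities
    would give D12, D13, D24, D34 <= 16/27. Then [v1] and [v4] are close to the plane of [v2], [v3],
    so c - a e is close to b f, which is large, and M = D12 D24 - (c - a e)^2 is too small. *)
Lemma orthogonal_bound (R : realFieldType) (a b c e f : R) :
  let M := 1 + 2 * a * c * e - a ^+ 2 - c ^+ 2 - e ^+ 2 in
  let N := 1 + 2 * b * c * f - b ^+ 2 - c ^+ 2 - f ^+ 2 in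
  let D12 := 1 - a ^+ 2 in let D13 := 1 - b ^+ 2 in let D14 := 1 - c ^+ 2 in
  let D24 := 1 - e ^+ 2 in let D34 := 1 - f ^+ 2 in
  0 < M -> 0 < N -> 0 < D12 -> 0 < D13 -> 0 < D14 -> 0 < D24 -> 0 < D34 ->
  (a * b + e * f - c * (a * f + b * e)) ^+ 2 <= M * N ->
  16 * (M * N) < 27 * (D12 * D13 * D14 * D24 * D34).
Proof.
(* Exchanging 2 and 3 swaps a with b and e with f. The chosen order serves to get 1 + r = D12 + D13
   <= 2 D13. *)
wlog ab : a b e f / b ^+ 2 <= a ^+ 2.
  move=> W M N D12 D13 D14 D24 D34 M0 N0 h12 h13 h14 h24 h34 H.
  case: (lerP (b ^+ 2) (a ^+ 2)) => [|/ltW] ab; first exact: W.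
  have -> : M * N = N * M by ring.
  have -> : D12 * D13 * D14 * D24 * D34 = D13 * D12 * D14 * D34 * D24 by ring.
  apply: W; rewrite // -/M -/N [N * M]mulrC; apply: le_trans H.
  by rewrite le_eqVlt; apply/orP; left; apply/eqP; ring.
move=> M N D12 D13 D14 D24 D34 M0 N0 h12 h13 h14 h24 h34 H.
rewrite ltNge; apply/negP => K.
have P12 := ltW h12; have P13 := ltW h13; have P14 := ltW h14.
have P24 := ltW h24; have P34 := ltW h34.
(* [r], [s], [rho] are the inner products of the components of [v1] and [v4]
   orthogonal to the orthonormal pair [v2], [v3] *)
pose r := 1 - a ^+ 2 - b ^+ 2; pose s := 1 - e ^+ 2 - f ^+ 2.
pose rho := c - a * e - b * f.
(* This is det A at d = 0, as the determinant of the Schur complement of the identity block on 2,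
   3. *)
have q0 : 0 <= r * s - rho ^+ 2.
  rewrite -(pmulr_lge0 _ h14).
  have -> : (r * s - rho ^+ 2) * D14
    = M * N - (a * b + e * f - c * (a * f + b * e)) ^+ 2.
    by rewrite /M /N /r /s /rho /D14; ring.
  by rewrite subr_ge0.
have r0 : 0 <= r.
  rewrite -(pmulr_lge0 _ M0).
  have -> : r * M = (r * s - rho ^+ 2) * D12
      + (f - a ^+ 2 * f + a * b * e - b * c) ^+ 2.
    by rewrite /M /r /s /rho /D12; ring.
  by rewrite addr_ge0 ?sqr_ge0 // mulr_ge0.
have s0 : 0 <= s.
  rewrite -(pmulr_lge0 _ M0).
  have -> : s * M = (r * s - rho ^+ 2) * D24
      + (b - e ^+ 2 * b + a * e * f - f * c) ^+ 2.
    by rewrite /M /r /s /rho /D24; ring.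
  by rewrite addr_ge0 ?sqr_ge0 // mulr_ge0.
have NU1 : N <= D14 * D34.
  by rewrite -subr_ge0 (_ : _ - N = (b - c * f) ^+ 2) ?sqr_ge0 // /N /D14 /D34; ring.
have NU2 : N <= D13 * D14.
  by rewrite -subr_ge0 (_ : _ - N = (f - b * c) ^+ 2) ?sqr_ge0 // /N /D13 /D14; ring.
have ME : M = D12 * D24 - (b * f + rho) ^+ 2.
  by rewrite /M /D12 /D24 /rho; ring.
have MU1 : M <= D14 * D24.
  by rewrite -subr_ge0 (_ : _ - M = (a - c * e) ^+ 2) ?sqr_ge0 // /M /D14 /D24; ring.
have MU2 : M <= D12 * D14.
  by rewrite -subr_ge0 (_ : _ - M = (e - a * c) ^+ 2) ?sqr_ge0 // /M /D12 /D14; ring.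
have MU3 : M <= D12 * D24 by rewrite ME gerBl sqr_ge0.
have NU3 : N <= D13 * D34.
  by rewrite -subr_ge0 (_ : _ - N = (c - b * f) ^+ 2) ?sqr_ge0 // /N /D13 /D34; ring.
have cancel (p q w : R) : 0 < q -> p * q <= w * q -> p <= w by move=> q1; rewrite ler_pM2r.
have K13 : 27 * (D12 * D24 * D13) <= 16 * M.
  apply: (@cancel _ (D14 * D34)); first exact: mulr_gt0.
  apply: le_trans (_ : 16 * (M * N) <= _).
    by apply: le_trans K; rewrite le_eqVlt; apply/orP; left; apply/eqP; ring.
  by rewrite -mulrA ler_wpM2l // ler_wpM2l // ltW.
have B13 : 27 * D13 <= 16.
  apply: (@cancel _ (D12 * D24)); first exact: mulr_gt0.
  rewrite -mulrA (mulrC D13); apply: le_trans K13 _.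
  by rewrite ler_wpM2l.
have B34 : 27 * D34 <= 16.
  apply: (@cancel _ (D12 * D24 * (D13 * D14))); first by rewrite !mulr_gt0.
  apply: le_trans (_ : 16 * (M * N) <= _).
    by apply: le_trans K; rewrite le_eqVlt; apply/orP; left; apply/eqP; ring.
  by rewrite ler_wpM2l // ler_pM // ltW.
have B12 : 27 * D12 <= 16.
  apply: (@cancel _ (D13 * D34 * (D14 * D24))); first by rewrite !mulr_gt0.
  apply: le_trans (_ : 16 * (M * N) <= _).
    by apply: le_trans K; rewrite le_eqVlt; apply/orP; left; apply/eqP; ring.
  by rewrite ler_wpM2l // mulrC ler_pM // ltW.
have B24 : 27 * D24 <= 16.
  apply: (@cancel _ (D13 * D34 * (D12 * D14))); first by rewrite !mulr_gt0.
  apply: le_trans (_ : 16 * (M * N) <= _).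
    by apply: le_trans K; rewrite le_eqVlt; apply/orP; left; apply/eqP; ring.
  by rewrite ler_wpM2l // mulrC ler_pM // ltW.
have rD : 1 + r <= 2 * D13 by rewrite /r /D13; lra.
have r5 : 27 * r <= 5 by rewrite /r /D12 /D13 in B12 B13 *; lra.
have s5 : 27 * s <= 5 by rewrite /s /D24 /D34 in B24 B34 *; lra.
have X0 : 0 <= D12 * D24 by rewrite mulr_ge0.
have X1 : 729 * (D12 * D24) <= 256.
  have : (27 * D12) * (27 * D24) <= 16 * 16 by apply: ler_pM => //; rewrite mulr_ge0.
  lra.
(* [K13] reads 16 (b f + rho)^2 <= D12 D24 (16 - 27 D13); insert [rD], then [X1]. *)
have L : 729 * (b * f + rho) ^+ 2 <= 40 - 216 * r.
  have : D12 * D24 * (27 * (1 + r)) <= D12 * D24 * (27 * (2 * D13)).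
    by rewrite ler_wpM2l // ler_wpM2l.
  have : 729 * (D12 * D24) * (5 - 27 * r) <= 256 * (5 - 27 * r).
    by rewrite ler_wpM2r //; lra.
  rewrite ME in K13; nra.
have R1 : 729 * rho ^+ 2 <= 135 * r.
  have : rho ^+ 2 <= r * s by rewrite -subr_ge0.
  have : r * (27 * s) <= r * 5 by rewrite ler_wpM2l.
  lra.
have bf : 11 <= 27 * `|b * f|.
  rewrite -(@ler_pXn2r _ 2) ?nnegrE ?mulr_ge0 // exprMn real_normK ?num_real // exprMn.
  have : 11 * 11 <= (27 * b ^+ 2) * (27 * f ^+ 2).
    by apply: ler_pM => //; rewrite /D13 /D34 in B13 B34; lra.
  lra.
pose w := 27 * `|rho|.
have w0 : 0 <= w by rewrite mulr_ge0.
have w2 : w ^+ 2 <= 135 * r.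
  by rewrite /w exprMn real_normK ?num_real //; lra.
have w5 : w <= 5.
  rewrite -(@ler_pXn2r _ 2) ?nnegrE //; lra.
have T : 11 - w <= 27 * `|b * f + rho|.
  have := lerB_normD (b * f) rho; rewrite /w; lra.
have T2 : (11 - w) ^+ 2 <= 40 - 216 * r.
  apply: le_trans L; have -> : 729 * (b * f + rho) ^+ 2 = (27 * `|b * f + rho|) ^+ 2.
    by rewrite exprMn real_normK ?num_real //; ring.
  by rewrite ler_pXn2r ?nnegrE ?mulr_ge0 //; lra.
(* Since r >= w^2 / 135, [T2] gives (11 - w)^2 + 8 w^2 / 5 <= 40, but the left-hand side always
   exceeds 74. *)
have := sqr_ge0 (w - 11 / 3); nra.
Qed.

(** * Positive definite matrices with unit diagonal *)

(** By Sylvester's identity the last hypothesis is D14 det A > 0; it confines d to an open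
    interval. *)
Lemma correlation_bound (R : rcfType) (a b c d e f : R) :
  let M := 1 + 2 * a * c * e - a ^+ 2 - c ^+ 2 - e ^+ 2 in
  let N := 1 + 2 * b * c * f - b ^+ 2 - c ^+ 2 - f ^+ 2 in
  let D12 := 1 - a ^+ 2 in let D13 := 1 - b ^+ 2 in let D14 := 1 - c ^+ 2 in
  let D24 := 1 - e ^+ 2 in let D34 := 1 - f ^+ 2 in
  0 < M -> 0 < N -> 0 < D12 -> 0 < D13 -> 0 < D14 -> 0 < D24 -> 0 < D34 ->
  (d * D14 - (a * b + e * f - c * (a * f + b * e))) ^+ 2 < M * N ->
  16 * (M * N * (1 - d ^+ 2)) < 27 * (D12 * D13 * D14 * D24 * D34).
Proof.
move=> M N D12 D13 D14 D24 D34 M0 N0 h12 h13 h14 h24 h34.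
set h := _ + e * f - _ => H.
have MN0 : 0 < M * N by rewrite mulr_gt0.
have [h0|h0] := lerP (h ^+ 2) (M * N).
  apply: le_lt_trans (orthogonal_bound M0 N0 h12 h13 h14 h24 h34 h0).
  by rewrite ler_pM2l // ger_pMr // gerBl sqr_ge0.
(* Here 0 lies outside the interval, and [d0] below is the endpoint nearest to 0. *)
pose t := Num.sg h * Num.sqrt (M * N).
have hn0 : h != 0.
  by apply: contraTneq h0 => ->; rewrite expr0n /= -leNgt ltW.
have s2 : Num.sg h ^+ 2 = 1 by rewrite sqr_sg hn0.
pose d0 := (h - t) / D14.
have d0d : d0 ^+ 2 < d ^+ 2.
  rewrite -(ltr_pM2r (exprn_gt0 2 h14)) -!exprMn /d0 divfK ?gt_eqF //.
  have E : Num.sg h * h = `|h| by rewrite normrEsg.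
  have -> : (h - t) ^+ 2 = (`|h| - Num.sqrt (M * N)) ^+ 2.
    by rewrite -E /t; ring: s2.
  have -> : (d * D14) ^+ 2 = (Num.sg h * (d * D14)) ^+ 2 by ring: s2.
  have : `|d * D14 - h| < Num.sqrt (M * N).
    by rewrite -sqrtr_sqr ltr_sqrt.
  have e1 : `|d * D14 - h| = `|Num.sg h * (d * D14) - `|h| |.
    by rewrite -E -mulrBr normrM normr_sg hn0 mul1r.
  rewrite {}e1 ltr_norml => /andP[k1 _].
  have k2 : Num.sqrt (M * N) < `|h|.
    by rewrite -sqrtr_sqr ltr_sqrt // exprn_even_gt0.
  rewrite ltr_pXn2r ?nnegrE //; lra.
have S (x : R) : 0 < x -> 0 < Num.sqrt x /\ Num.sqrt x ^+ 2 = x.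
  by move=> x0; rewrite sqrtr_gt0 x0 sqr_sqrtr // ltW.
have [[x0 xx] [y0 yy]] := (S _ h12, S _ h13); have [z0 zz] := S _ h14.
have [[u0 uu] [v0 vv]] := (S _ h24, S _ h34).
have [[_ mm] [_ nn]] := (S _ M0, S _ N0).
(* Giving the sign of [h] to [n] selects the right root. *)
have nn' : (Num.sg h * Num.sqrt N) ^+ 2 = N by rewrite exprMn s2 mul1r.
have := @singular_det_bound _ a b c d0 e f _ _ _ _ _ _ _ x0 y0 z0 u0 v0 xx yy zz uu vv mm nn'.
rewrite xx yy zz uu vv mm nn'.
have d0E : d0 = (h - Num.sqrt M * (Num.sg h * Num.sqrt N)) / D14.
  by rewrite /d0 /t sqrtrM ?ltW // mulrCA.
move=> /(_ d0E).
have : M * N * (1 - d ^+ 2) < M * N * (1 - d0 ^+ 2) by rewrite ltr_pM2l // ltrD2l ltrN2.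
lra.
Qed.

Definition quad4 (R : pzRingType) (p q r s a b c d e f x y z w : R) : R :=
  p * x ^+ 2 + q * y ^+ 2 + r * z ^+ 2 + s * w ^+ 2
  + 2 * (a * x * y + b * x * z + c * x * w + d * y * z + e * y * w + f * z * w).

Lemma correlation_bound_quad (R : rcfType) (a b c d e f : R) :
  (forall x y z w, [|| x != 0, y != 0, z != 0 | w != 0] ->
    0 < quad4 1 1 1 1 a b c d e f x y z w) ->
  16 * ((1 + 2 * a * c * e - a ^+ 2 - c ^+ 2 - e ^+ 2)
      * (1 + 2 * b * c * f - b ^+ 2 - c ^+ 2 - f ^+ 2) * (1 - d ^+ 2)) <
  27 * ((1 - a ^+ 2) * (1 - b ^+ 2) * (1 - c ^+ 2) * (1 - e ^+ 2) * (1 - f ^+ 2))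
  /\ [/\ 0 < 1 - a ^+ 2, 0 < 1 - b ^+ 2, 0 < 1 - c ^+ 2, 0 < 1 - e ^+ 2 & 0 < 1 - f ^+ 2].
Proof.
move=> Q.
(* Each test vector is some vj minus its projection on some vi. *)
have h12 : 0 < 1 - a ^+ 2.
  have := Q (- a) 1 0 0; rewrite oner_eq0 orbT => /(_ isT).
  by congr (_ < _); rewrite /quad4; ring.
have h13 : 0 < 1 - b ^+ 2.
  have := Q (- b) 0 1 0; rewrite oner_eq0 !orbT => /(_ isT).
  by congr (_ < _); rewrite /quad4; ring.
have h14 : 0 < 1 - c ^+ 2.
  have := Q (- c) 0 0 1; rewrite oner_eq0 !orbT => /(_ isT).
  by congr (_ < _); rewrite /quad4; ring.
have h24 : 0 < 1 - e ^+ 2.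
  have := Q 0 (- e) 0 1; rewrite oner_eq0 !orbT => /(_ isT).
  by congr (_ < _); rewrite /quad4; ring.
have h34 : 0 < 1 - f ^+ 2.
  have := Q 0 0 (- f) 1; rewrite oner_eq0 !orbT => /(_ isT).
  by congr (_ < _); rewrite /quad4; ring.
(* The vector is 1 - c^2 times the component of [v2] orthogonal to [v1] and [v4]. *)
have M0 : 0 < 1 + 2 * a * c * e - a ^+ 2 - c ^+ 2 - e ^+ 2.
  rewrite -(pmulr_lgt0 _ h14).
  have := Q (c * e - a) (1 - c ^+ 2) 0 (a * c - e); rewrite (gt_eqF h14) !orbT => /(_ isT).
  by congr (_ < _); rewrite /quad4; ring.
have N0 : 0 < 1 + 2 * b * c * f - b ^+ 2 - c ^+ 2 - f ^+ 2.
  rewrite -(pmulr_lgt0 _ h14).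
  have := Q (c * f - b) 0 (1 - c ^+ 2) (b * c - f); rewrite (gt_eqF h14) !orbT => /(_ isT).
  by congr (_ < _); rewrite /quad4; ring.
split=> //; apply: correlation_bound => //.
rewrite -subr_gt0 -(pmulr_rgt0 _ (mulr_gt0 h14 M0)).
set M := (X in (1 - c ^+ 2) * X) in M0 *.
pose W := d * (1 - c ^+ 2) - (a * b + e * f - c * (a * f + b * e)).
(* the vector is - W p2 + M p3, where pi is (1 - c^2) times the component of vi
   orthogonal to v1 and v4 *)
have := Q (- W * (c * e - a) + M * (c * f - b)) (- W * (1 - c ^+ 2)) (M * (1 - c ^+ 2))
  (- W * (a * c - e) + M * (b * c - f)).
rewrite (mulf_neq0 (lt0r_neq0 M0) (lt0r_neq0 h14)) !orbT => /(_ isT).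
by congr (_ < _); rewrite /quad4 /W /M; ring.
Qed.

(** * Minors and the quadratic form in coordinates *)

(** Trades the opaque size [#|a|] for a numeral, so that determinants can be expanded. *)
Lemma pminor_enum (R : comPzRingType) (n : nat) (A : 'M[R]_n) (a : {set 'I_n})
    (i0 : 'I_n) (s : seq 'I_n) :
  enum a = s ->
  pminor A a = \det (\matrix_(i < size s, j < size s) A (nth i0 s i) (nth i0 s j)).
Proof.
move=> <-; rewrite -cardE; congr (\det _); apply/matrixP => i j.
by rewrite !mxE -!enum_val_nth.
Qed.

Lemma det_mx22 (R : comPzRingType) (B : 'M[R]_2) :
  \det B = B 0 0 * B 1 1 - B 0 1 * B 1 0.
Proof.
rewrite (expand_det_row _ 0) !big_ord_recl big_ord0 /cofactor !det_mx11 !mxE /=.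
rewrite expr0 expr1 mul1r mulN1r addr0 mulrN.
by congr (B _ _ * B _ _ - B _ _ * B _ _); apply: val_inj.
Qed.

Lemma det_mx33 (R : comPzRingType) (B : 'M[R]_3) :
  \det B = B 0 0 * (B 1 1 * B 2 2 - B 1 2 * B 2 1)
         - B 0 1 * (B 1 0 * B 2 2 - B 1 2 * B 2 0)
         + B 0 2 * (B 1 0 * B 2 1 - B 1 1 * B 2 0).
Proof.
rewrite (expand_det_row _ 0) !big_ord_recl big_ord0 /cofactor !det_mx22 !mxE /=.
rewrite expr0 expr1 sqrrN expr1n !mul1r mulN1r addr0 mulrN addrA.
by congr (B _ _ * (B _ _ * B _ _ - B _ _ * B _ _)
  - B _ _ * (B _ _ * B _ _ - B _ _ * B _ _)
  + B _ _ * (B _ _ * B _ _ - B _ _ * B _ _)); apply: val_inj.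
Qed.

Lemma enum_ord4 : enum 'I_4 = [:: 0; 1; 2; 3].
Proof. by apply: (inj_map val_inj); rewrite val_enum_ord. Qed.

Lemma enum_set4 (a : {set 'I_4}) : enum a = [seq i <- [:: 0; 1; 2; 3] | i \in a].
Proof. by rewrite -enum_ord4 enumT. Qed.

Lemma pminor1 (R : comPzRingType) (A : 'M[R]_4) (i : 'I_4) : pminor A [set i] = A i i.
Proof.
by rewrite (pminor_enum _ i (enum_set1 i)) det_mx11 mxE.
Qed.

Lemma pminor2 (R : comPzRingType) (A : 'M[R]_4) (a : {set 'I_4}) (i j : 'I_4) :
  enum a = [:: i; j] -> pminor A a = A i i * A j j - A i j * A j i.
Proof. by move=> /(pminor_enum A i) ->; rewrite det_mx22 !mxE. Qed.

Lemma pminor3 (R : comPzRingType) (A : 'M[R]_4) (a : {set 'I_4}) (i j k : 'I_4) :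
  enum a = [:: i; j; k] ->
  pminor A a = A i i * (A j j * A k k - A j k * A k j)
             - A i j * (A j i * A k k - A j k * A k i)
             + A i k * (A j i * A k j - A j j * A k i).
Proof. by move=> /(pminor_enum A i) ->; rewrite det_mx33 !mxE. Qed.

Lemma symmetricmxP (R : fieldType) (n : nat) (A : 'M[R]_n) :
  reflect (forall i j, A i j = A j i) (A \is symmetricmx).
Proof.
apply: (iffP (is_hermitianmxP _ _ _)); rewrite expr0 scale1r.
  by move=> sA i j; rewrite {1}sA !mxE.
by move=> S; apply/matrixP => i j; rewrite !mxE S.
Qed.

Lemma detratioE (R : fieldType) (A : 'M[R]_4) : A \is symmetricmx ->
  let p := A 0 0 in let q := A 1 1 in let r := A 2 2 in let s := A 3 3 in
  let a := A 0 1 in let b := A 0 2 in let c := A 0 3 in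
  let d := A 1 2 in let e := A 1 3 in let f := A 2 3 in
  detratio A =
  ((p * q * s + 2 * a * c * e - q * c ^+ 2 - p * e ^+ 2 - s * a ^+ 2)
    * (p * r * s + 2 * b * c * f - r * c ^+ 2 - p * f ^+ 2 - s * b ^+ 2)
    * (q * r - d ^+ 2) * p * s)
  / ((p * q - a ^+ 2) * (p * r - b ^+ 2) * (p * s - c ^+ 2) * (q * s - e ^+ 2)
    * (r * s - f ^+ 2)).
Proof.
move=> /symmetricmxP S /=.
rewrite /detratio !pminor1.
rewrite (@pminor3 _ A [set 0; 1; 3] 0 1 3) ?enum_set4 /= ?inE //.
rewrite (@pminor3 _ A [set 0; 2; 3] 0 2 3) ?enum_set4 /= ?inE //.
rewrite (@pminor2 _ A [set 1; 2] 1 2) ?enum_set4 /= ?inE //.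
rewrite (@pminor2 _ A [set 0; 1] 0 1) ?enum_set4 /= ?inE //.
rewrite (@pminor2 _ A [set 0; 2] 0 2) ?enum_set4 /= ?inE //.
rewrite (@pminor2 _ A [set 0; 3] 0 3) ?enum_set4 /= ?inE //.
rewrite (@pminor2 _ A [set 1; 3] 1 3) ?enum_set4 /= ?inE //.
rewrite (@pminor2 _ A [set 2; 3] 2 3) ?enum_set4 /= ?inE //.
rewrite (S 1 0) (S 2 0) (S 3 0) (S 2 1) (S 3 1) (S 3 2).
congr (_ / _); ring.
Qed.

Lemma quad4E (R : fieldType) (A : 'M[R]_4) (v : 'cV[R]_4) : A \is symmetricmx ->
  (v^T *m A *m v) 0 0 = quad4 (A 0 0) (A 1 1) (A 2 2) (A 3 3)
    (A 0 1) (A 0 2) (A 0 3) (A 1 2) (A 1 3) (A 2 3) (v 0 0) (v 1 0) (v 2 0) (v 3 0).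
Proof.
move=> /symmetricmxP S.
have sum4 (F : 'I_4 -> R) : \sum_i F i = F 0 + F 1 + F 2 + F 3.
  rewrite !big_ord_recl big_ord0 addr0 !addrA.
  by congr (F _ + F _ + F _ + F _); apply: val_inj.
rewrite !mxE sum4 !mxE !sum4 !mxE.
rewrite (S 1 0) (S 2 0) (S 3 0) (S 2 1) (S 3 1) (S 3 2) /quad4; ring.
Qed.

Lemma posdefmx4P (R : realFieldType) (A : 'M[R]_4) :
  posdefmx A <-> A \is symmetricmx /\ forall x y z w : R,
    [|| x != 0, y != 0, z != 0 | w != 0] ->
    0 < quad4 (A 0 0) (A 1 1) (A 2 2) (A 3 3)
      (A 0 1) (A 0 2) (A 0 3) (A 1 2) (A 1 3) (A 2 3) x y z w.
Proof.
split=> -[sA Q]; split=> //.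
  move=> x y z w nz; pose v : 'cV[R]_4 := \col_i nth 0 [:: x; y; z; w] i.
  have := Q v; rewrite (quad4E _ sA) !mxE; apply.
  apply: contraTneq nz => v0.
  have := congr1 (fun u : 'cV[R]_4 => (u 0 0, u 1 0, u 2 0, u 3 0)) v0.
  by rewrite !mxE => -[-> -> -> ->]; rewrite eqxx.
move=> v; apply: contraNT; rewrite (quad4E _ sA) => /negP H.
apply/eqP/matrixP => i j; rewrite (ord1 j) mxE.
have {}H : ~~ [|| v 0 0 != 0, v 1 0 != 0, v 2 0 != 0 | v 3 0 != 0].
  by apply/negP => /Q.
move: H; rewrite !negb_or !negbK => /and4P[/eqP h0 /eqP h1 /eqP h2 /eqP h3].
case: i => -[|[|[|[|//]]]] p;
  [rewrite -[RHS]h0 | rewrite -[RHS]h1 | rewrite -[RHS]h2 | rewrite -[RHS]h3].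
all: by congr (v _ _); apply: val_inj.
Qed.

(** * Reduction to unit diagonal *)

Lemma quad4_ratio_bound (R : rcfType) (p q r s a b c d e f : R) :
  (forall x y z w, [|| x != 0, y != 0, z != 0 | w != 0] ->
    0 < quad4 p q r s a b c d e f x y z w) ->
  ((p * q * s + 2 * a * c * e - q * c ^+ 2 - p * e ^+ 2 - s * a ^+ 2)
    * (p * r * s + 2 * b * c * f - r * c ^+ 2 - p * f ^+ 2 - s * b ^+ 2)
    * (q * r - d ^+ 2) * p * s)
  / ((p * q - a ^+ 2) * (p * r - b ^+ 2) * (p * s - c ^+ 2) * (q * s - e ^+ 2)
    * (r * s - f ^+ 2)) < 27 / 16.
Proof.
move=> Q.
have p0 : 0 < p.
  have := Q 1 0 0 0; rewrite oner_eq0 => /(_ isT).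
  by congr (_ < _); rewrite /quad4; ring.
have q0 : 0 < q.
  have := Q 0 1 0 0; rewrite oner_eq0 orbT => /(_ isT).
  by congr (_ < _); rewrite /quad4; ring.
have r0 : 0 < r.
  have := Q 0 0 1 0; rewrite oner_eq0 !orbT => /(_ isT).
  by congr (_ < _); rewrite /quad4; ring.
have s0 : 0 < s.
  have := Q 0 0 0 1; rewrite oner_eq0 !orbT => /(_ isT).
  by congr (_ < _); rewrite /quad4; ring.
have S (x : R) : 0 < x -> exists2 y, y != 0 & x = y ^+ 2.
  move=> x0; exists (Num.sqrt x); last by rewrite sqr_sqrtr // ltW.
  by rewrite gt_eqF // sqrtr_gt0.
move: (S _ p0) (S _ q0) (S _ r0) (S _ s0) => [P np ep] [T nt eq] [U nu er] [V nv es].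
have D (x y z : R) : x != 0 -> y != 0 -> exists t, z = x * y * t.
  by move=> hx hy; exists (z / (x * y)); rewrite mulrC divfK // mulf_neq0.
have [a' ea] := D P T a np nt; have [b' eb] := D P U b np nu.
have [c' ec] := D P V c np nv; have [d' ed] := D T U d nt nu.
have [e' ee] := D T V e nt nv; have [f' ef] := D U V f nu nv.
subst p q r s a b c d e f.
have /correlation_bound_quad [] : forall x y z w, [|| x != 0, y != 0, z != 0 | w != 0] ->
    0 < quad4 1 1 1 1 a' b' c' d' e' f' x y z w.
  move=> x y z w nz.
  have := Q (x / P) (y / T) (z / U) (w / V).
  rewrite !mulf_eq0 !invr_eq0 (negbTE np) (negbTE nt) (negbTE nu) (negbTE nv) !orbF.
  move=> /(_ nz); congr (_ < _); rewrite /quad4; field.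
  by rewrite np nt nu nv.
set M := (X in X * _ * _); set N := (X in _ * X * _) => B [h12 h13 h14 h24 h34].
rewrite [X in X * _ * _ * _ * _ / _](_ : _ = P ^+ 2 * T ^+ 2 * V ^+ 2 * M); last first.
  by rewrite /M; ring.
rewrite [X in _ * X * _ * _ * _ / _](_ : _ = P ^+ 2 * U ^+ 2 * V ^+ 2 * N); last first.
  by rewrite /N; ring.
rewrite [X in _ * X * _ * _ / _](_ : _ = T ^+ 2 * U ^+ 2 * (1 - d' ^+ 2)); last by ring.
have E (x y z : R) : x ^+ 2 * y ^+ 2 - (x * y * z) ^+ 2 = x ^+ 2 * y ^+ 2 * (1 - z ^+ 2) by ring.
rewrite !E.
move: B; move: M N (1 - a' ^+ 2) (1 - b' ^+ 2) (1 - c' ^+ 2) (1 - e' ^+ 2) (1 - f' ^+ 2)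
  h12 h13 h14 h24 h34.
move=> M N D12 D13 D14 D24 D34 h12 h13 h14 h24 h34 B.
(* Numerator and denominator share the factor P^6 T^4 U^4 V^6. *)
rewrite [ltLHS](_ : _ = M * N * (1 - d' ^+ 2) / (D12 * D13 * D14 * D24 * D34)).
  rewrite ltr_pdivrMr ?mulr_gt0 //; lra.
by field; rewrite np nt nu nv !gt_eqF.
Qed.

Lemma detratio_bound (R : rcfType) (A : 'M[R]_4) : posdefmx A -> detratio A < 27 / 16.
Proof.
move=> /posdefmx4P[sA Q]; rewrite detratioE //; exact: quad4_ratio_bound.
Qed.

(** * The extremal family *)

Lemma Aeps_sym (R : fieldType) (e : R) : Aeps e \is symmetricmx.
Proof.
apply/symmetricmxP => i j; rewrite !mxE.
by case: i => -[|[|[|[|//]]]] pi; case: j => -[|[|[|[|//]]]] pj.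
Qed.

(** A factor e^5 cancels, leaving a function continuous at 0 with value 27/16. *)
Lemma detratio_Aeps (R : realFieldType) (e : R) : 0 < e < 1 ->
  detratio (Aeps e) = (3 - 2 * e) ^+ 2 * (3 - e) * (1 - e) / (2 - e) ^+ 4.
Proof.
move=> /andP[e0 e1]; rewrite detratioE ?Aeps_sym // !mxE /=.
have E : 1 * 1 - (1 - e) ^+ 2 = e * (2 - e) by ring.
rewrite E.
have n2 : 2 - e != 0 by lra.
by field; rewrite n2 gt_eqF.
Qed.

Lemma posdefmx_Aeps (R : realFieldType) (e : R) : 0 < e < 1 -> posdefmx (Aeps e).
Proof.
move=> /andP[e0 e1]; apply/posdefmx4P; split; first exact: Aeps_sym.
move=> x y z w nz; rewrite !mxE /=.
(* The symmetries exchanging x, w and y, z split off x - w and y - z; the rest completes the square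
   in x + w. *)
have -> : quad4 1 1 1 1 (1 - e) (1 - e) (1 - e) (1 - 3 * e + e ^+ 2) (1 - e) (1 - e) x y z w
  = e / 2 * (x - w) ^+ 2 + (3 - e) * e / 2 * (y - z) ^+ 2
   + ((2 - e) * (x + w) + 2 * (1 - e) * (y + z)) ^+ 2 / (2 * (2 - e))
   + (1 - e) * e ^+ 2 / (2 * (2 - e)) * (y + z) ^+ 2.
  rewrite /quad4; field; lra.
have c1 : 0 < e / 2 by lra.
have c2 : 0 < (3 - e) * e / 2 by rewrite !mulr_gt0 //; lra.
have c3 : 0 < (2 * (2 - e))^-1 by rewrite invr_gt0; lra.
have c4 : 0 < (1 - e) * e ^+ 2 / (2 * (2 - e)) by rewrite !mulr_gt0 // ?exprn_gt0 //; lra.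
set k1 := e / 2 in c1 *; set k2 := _ * e / 2 in c2 *; set k4 := _ / _ in c4 *.
set k3 := _^-1 in c3 *; clearbody k1 k2 k3 k4.
have t1 := mulr_ge0 (ltW c1) (sqr_ge0 (x - w)).
have t2 := mulr_ge0 (ltW c2) (sqr_ge0 (y - z)).
set g := _ + 2 * (1 - e) * _.
have t3 : 0 <= g ^+ 2 * k3 by rewrite mulr_ge0 ?sqr_ge0 ?ltW.
have t4 := mulr_ge0 (ltW c4) (sqr_ge0 (y + z)).
rewrite lt_neqAle; apply/andP; split; last by rewrite !addr_ge0.
apply: contraL nz; rewrite eq_sym !paddr_eq0 ?addr_ge0 //.
rewrite !mulf_eq0 !(gt_eqF c1, gt_eqF c2, gt_eqF c3, gt_eqF c4) /= ?orbF.
rewrite !orbb /g => /andP[/andP[/andP[/eqP xw /eqP yz] /eqP g0] /eqP yz'].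
have y0 : y = 0 by lra.
have z0 : z = 0 by lra.
have {}g0 : (2 - e) * (x + w) = 0 by move: g0; rewrite yz' mulr0 addr0.
have /eqP : x + w = 0 by move/eqP: g0; rewrite mulf_eq0 => /orP[/eqP|/eqP//]; lra.
have -> : x = w by lra.
rewrite -mulr2n mulrn_eq0 /= => /eqP w0.
by rewrite y0 z0 w0 eqxx.
Qed.

Lemma cvg_detratio_Aeps (R : realType) :
  detratio (Aeps e) @[e --> (0 : R)^'+] --> (27 / 16 : R).
Proof.
apply: (cvg_trans (G := (3 - 2 * e) ^+ 2 * (3 - e) * (1 - e) / (2 - e) ^+ 4
          @[e --> (0 : R)^'+])).
  apply: near_eq_cvg; near=> e; rewrite detratio_Aeps //; apply/andP; split.
    by near: e; exact: nbhs_right_gt.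
  by near: e; exact: nbhs_right_lt.
apply: cvg_at_right_filter.
have e0 : e @[e --> (0 : R)] --> (0 : R) by exact: cvg_id.
have lin (k : R) : k - e @[e --> (0 : R)] --> k.
  by rewrite -[X in _ --> X]subr0; apply: cvgB => //; exact: cvg_cst.
have l2 : 3 - 2 * e @[e --> (0 : R)] --> (3 : R).
  rewrite -[X in _ --> X]subr0 -[X in _ - X](mulr0 2).
  by apply: cvgB; [exact: cvg_cst | apply: cvgM => //; exact: cvg_cst].
have -> : 27 / 16 = 3 ^+ 2 * 3 * 1 / 2 ^+ 4 :> R by field.
apply: cvgM; last first.
  apply: cvgV; first by rewrite expf_neq0.
  rewrite !exprS expr0 mulr1; under eq_fun do rewrite !exprS expr0 mulr1.
  by repeat apply: cvgM; apply: lin.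
by repeat apply: cvgM.
Unshelve. all: by end_near. Qed.

Theorem theorem1p1 (R : realType) :
  [/\ forall A : 'M[R]_4, posdefmx A -> detratio A < 27 / 16,
      sup [set detratio A | A in [set A : 'M[R]_4 | posdefmx A]] = 27 / 16,
      \forall e \near (0 : R)^'+, posdefmx (Aeps e) &
      detratio (Aeps e) @[e --> (0 : R)^'+] --> (27 / 16 : R)].
Proof.
have bnd (A : 'M[R]_4) : posdefmx A -> detratio A < 27 / 16 by exact: detratio_bound.
have pd : \forall e \near (0 : R)^'+, posdefmx (Aeps e).
  near=> e; apply: posdefmx_Aeps; apply/andP; split.
    by near: e; exact: nbhs_right_gt.
  by near: e; exact: nbhs_right_lt.
have cvg := @cvg_detratio_Aeps R; split=> //.
set S := (X in sup X).
have ubS : ubound S (27 / 16) by move=> _ [A pA <-]; exact/ltW/bnd.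
have S0 : S !=set0.
  exists (detratio (Aeps (1 / 2))), (Aeps (1 / 2)) => //=.
  by apply: posdefmx_Aeps; lra.
apply/eqP; rewrite eq_le ge_sup //=.
(* The supremum dominates the values along the family, hence their limit. *)
apply: (cvgr_to_le cvg).
near=> e; apply: ub_le_sup; first by exists (27 / 16).
by exists (Aeps e) => //=; near: e.
Unshelve. all: by end_near. Qed.
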